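(* Suppose Assumption 1 (stated in the context) holds. Then, for any level $\ell=1,2,\dots,\mathsf{L}$: (1) The Markov chain on $(\mathsf{X}^2,\mathcal{B}(\mathsf{X}^2))$ generated by the joint kernel $\bm p_\ell$ has a unique invariant probability measure $\nu_\ell$. (2) This chain is uniformly ergodic: there exist a bounded, $\nu_\ell$-integrable function $V_{\ell-1,\ell}:\mathsf{X}^2\to[1,V_{\max,\ell}]$ (with $V_{\max,\ell}<\infty$), constants $r\in(0,1)$ and $M\in(0,\infty)$ such that $$\sup_{|f|\le V_{\ell-1,\ell}}\Big|(\bm P_\ell^n f)(\bm\theta_\ell)-\int_{\mathsf{X}^2} f\,\mathrm{d}\nu_\ell\Big|\le M V_{\max,\ell}\, r^n\qquad\forall \bm\theta_\ell\in\mathsf{X}^2,\ n\in\mathbb{N},$$ where the supremum is over all $\nu_\ell$-measurable $f:\mathsf{X}^2\to\mathbb{R}$ with $|f(\bm\theta_\ell)|\le V_{\ell-1,\ell}(\bm\theta_\ell)$ for all $\bm\theta_\ell\in\mathsf{X}^2$.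
   Context: Setting: $\mathsf{X}$ is a separable Banach space with Borel $\sigma$-algebra $\mathcal{B}(\mathsf{X})$, $\mu_{\mathrm{pr}}$ is a (prior) probability measure on $\mathsf{X}$. For levels $j=0,1,\dots,\mathsf{L}$, $\mu^y_j$ is a probability measure (posterior) on $\mathsf{X}$ with density $\pi^y_j$ with respect to $\mu_{\mathrm{pr}}$. For $\ell=1,\dots,\mathsf{L}$, $Q_\ell$ is a probability density with respect to $\mu_{\mathrm{pr}}$ (the independent proposal). For $j\in\{\ell-1,\ell\}$ and $\theta,z\in\mathsf{X}$ define the acceptance probability $\alpha_j(\theta,z)=\min\{1,\frac{\pi^y_j(z)Q_\ell(\theta)}{\pi^y_j(\theta)Q_\ell(z)}\}$. Joint kernel: for $\bm\theta_\ell=(\theta_{\ell,\ell-1},\theta_{\ell,\ell})\in\mathsf{X}^2$ and $A\in\mathcal{B}(\mathsf{X}^2)$, $\bm p_\ell(\bm\theta_\ell,A)=\int_\mathsf{X}\min\{\alpha_{\ell-1}(\theta_{\ell,\ell-1},z),\alpha_\ell(\theta_{\ell,\ell},z)\}\mathbf 1_{\{(z,z)\in A\}}Q_\ell(z)\mu_{\mathrm{pr}}(\mathrm{d}z)+\int_\mathsf{X}(\alpha_{\ell-1}(\theta_{\ell,\ell-1},z)-\alpha_\ell(\theta_{\ell,\ell},z))^+\mathbf 1_{\{(z,\theta_{\ell,\ell})\in A\}}Q_\ell(z)\mu_{\mathrm{pr}}(\mathrm{d}z)+\int_\mathsf{X}(\alpha_\ell(\theta_{\ell,\ell},z)-\alpha_{\ell-1}(\theta_{\ell,\ell-1},z))^+\mathbf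 1_{\{(\theta_{\ell,\ell-1},z)\in A\}}Q_\ell(z)\mu_{\mathrm{pr}}(\mathrm{d}z)+\mathbf 1_{\{\bm\theta_\ell\in A\}}\big(1-\int_\mathsf{X}\max\{\alpha_{\ell-1}(\theta_{\ell,\ell-1},z),\alpha_\ell(\theta_{\ell,\ell},z)\}Q_\ell(z)\mu_{\mathrm{pr}}(\mathrm{d}z)\big)$. (This is the kernel of two independent Metropolis–Hastings chains targeting $\mu^y_{\ell-1},\mu^y_\ell$ that share the same proposal $z\sim Q_\ell\mu_{\mathrm{pr}}$ and the same uniform random number for acceptance.) $\bm P_\ell$ denotes the associated Markov operator $(\bm P_\ell f)(\bm\theta)=\int f(\bm\eta)\bm p_\ell(\bm\theta,\mathrm{d}\bm\eta)$. Assumption 1: for all $\ell=1,\dots,\mathsf{L}$: (1.1) $Q_\ell$ is continuous and $Q_\ell(z)>0$ for all $z\in\mathsf{X}$; (1.2) $\pi^y_\ell$ is continuous and $\pi^y_\ell(z)>0$ for all $z$ (for all levels); (1.3) for $j=\ell-1,\ell$ and every $c_r>0$, the set $\{\theta\in\mathsf{X}: Q_\ell(\theta)/\pi^y_j(\theta)\le c_r\}$ is compact; (1.4) there exists $c\in(0,1)$ independent of $\ell$ with $\operatorname{ess\,inf}_{z\in\mathsf{X}}Q_\ell(z)/\pi^y_j(z)\ge c$ for $j=\ell-1,\ell$; (1.5) there exist $r>1$, $C_r>0$ independent of $\ell$ with $\int_\mathsf{X}Q_\ell^r\,\mathrm{d}\mu_{\mathrm{pr}}\le C_r$. *)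

(* Defs.v *)
From HB Require Import structures.
From mathcomp Require Import all_boot all_order all_algebra.
From mathcomp Require Import all_classical all_reals all_analysis.
From mathcomp Require Import ess_sup_inf.

Set Implicit Arguments.
Unset Strict Implicit.
Unset Printing Implicit Defensive.
Import Order.TTheory GRing.Theory Num.Theory.
Import numFieldNormedType.Exports.
Local Open Scope classical_set_scope.
Local Open Scope ring_scope.

Definition borel (T : topologicalType) := g_sigma_algebraType (@open T).

Definition separable_space (T : topologicalType) : Prop :=
  exists D : set T, countable D /\ closure D = setT.

Section MLMCMH.
Context {R : realType} {V : normedModType R}.

Definition is_density (mu : {measure set (borel V) -> \bar R}) (g : V -> R) :=
  (forall x, 0 <= g x) /\ measurable_fun setT (g : borel V -> R) /\
  (\int[mu]_x (g x)%:E = 1)%E.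

(* acceptance probability of the independent MH sampler, target density pi,
   proposal density Q *)
Definition alpha (pi Q : V -> R) (th z : V) : R :=
  Num.min 1 (pi z * Q th / (pi th * Q z)).

(* Markov operator (P f)(theta) = int f(eta) p(theta, d eta) of the coupled
   kernel: pa = pi_{l-1}, pb = pi_l, Q = Q_l. *)
Definition Pop (mu : {measure set (borel V) -> \bar R}) (pa pb Q : V -> R)
    (f : V * V -> R) (th : V * V) : R :=
  \int[mu]_z (Num.min (alpha pa Q th.1 z) (alpha pb Q th.2 z) * f (z, z) * Q z)
  + \int[mu]_z (Num.max 0 (alpha pa Q th.1 z - alpha pb Q th.2 z)
                  * f (z, th.2) * Q z)
  + \int[mu]_z (Num.max 0 (alpha pb Q th.2 z - alpha pa Q th.1 z)
                  * f (th.1, z) * Q z)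
  + f th * (1 - \int[mu]_z (Num.max (alpha pa Q th.1 z) (alpha pb Q th.2 z)
                             * Q z)).

(* The joint kernel p_l(theta, A): the operator applied to the indicator 1_A,
   which is literally the defining formula of p_l. *)
Definition pker (mu : {measure set (borel V) -> \bar R}) (pa pb Q : V -> R)
    (th : V * V) (A : set (V * V)) : R :=
  Pop mu pa pb Q (fun eta => \1_A eta) th.

Definition kernel_invariant (mu : {measure set (borel V) -> \bar R}) (pa pb Q : V -> R)
    (nu : {measure set (borel (V * V)%type) -> \bar R}) : Prop :=
  forall A : set (borel (V * V)%type), measurable A ->
    nu A = (\int[nu]_t (pker mu pa pb Q t A)%:E)%E.

End MLMCMH.

(* Main.v *)
Require Import Defs.
From HB Require Import structures.
From mathcomp Require Import all_boot all_order all_algebra.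
From mathcomp Require Import all_classical all_reals all_analysis.
From mathcomp Require Import ess_sup_inf measurable_realfun ring lra.
Import Order.TTheory GRing.Theory Num.Theory.
Import numFieldNormedType.Exports.
Local Open Scope classical_set_scope.
Local Open Scope ring_scope.

(* The coupled chain satisfies a Doeblin condition on the whole space. The ratio
   Q/pi_j is continuous and positive with compact sublevel sets, so pi_j <= M Q
   everywhere for some M, and then alpha_j(th, z) Q(z) >= pi_j(z) / M. Hence
   both chains jump to a common point at least as often as under the measure
   min(pi_{l-1}, pi_l) mu / M carried by the diagonal, which has positive mass.

   A Markov operator P that dominates a measure of mass beta shrinks the
   oscillation of every bounded measurable f by the factor 1 - beta, so P^n f
   tends uniformly and geometrically to a constant L f. The functional L is
   linear and continuous under bounded pointwise convergence, hence is the
   integral against a probability nu, which is invariant, and the only such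
   measure because any invariant nu' satisfies nu'(f) = nu'(P^n f) -> L f. *)

(** * Bounded measurable functions, and functionals determined by indicators *)

Section bounded_measurable.
Context {d : measure_display} {T : measurableType d} {R : realType}.
Implicit Types (f g : T -> R) (C D : R).

Definition bounded_mfun C f := measurable_fun setT f /\ forall t, `|f t| <= C.

Lemma bounded_mfun_ge0 C f : bounded_mfun C f -> 0 <= C.
Proof. by move=> [_ /(_ point)]; exact: le_trans. Qed.

Lemma bounded_mfun_cst (c : R) : bounded_mfun `|c| (cst c : T -> R).
Proof. by split. Qed.

Lemma bounded_mfun_lin (a : R) C D f g : bounded_mfun C f -> bounded_mfun D g ->
  bounded_mfun (`|a| * C + D) (fun x => a * f x + g x).
Proof.
move=> [mf fC] [mg gD]; split=> [|t].
  by apply: measurable_funD => //; exact: measurable_funM.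
by rewrite (le_trans (ler_normD _ _))// lerD// normrM ler_wpM2l.
Qed.

Lemma bounded_mfun_indic (A : set T) : measurable A ->
  bounded_mfun 1 (\1_A : T -> R).
Proof.
move=> mA; split=> [|t]; first exact: measurable_indic.
by rewrite indicE; case: (_ \in _); rewrite /= ?normr1 ?normr0.
Qed.

Lemma bounded_mfun_integrable (mu : {finite_measure set T -> \bar R}) C f :
  bounded_mfun C f -> mu.-integrable setT (EFin \o f).
Proof.
move=> [mf fC]; apply: measurable_bounded_integrable => //.
  by rewrite -ge0_fin_numE// fin_num_measure.
by exists C; split; [exact: num_real|move=> x Cx t _; exact: le_trans (ltW Cx)].
Qed.

Lemma Rintegral_bounded_lin (mu : {finite_measure set T -> \bar R}) (a : R)
    C D f g :
  bounded_mfun C f -> bounded_mfun D g ->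
  \int[mu]_x (a * f x + g x) = a * \int[mu]_x f x + \int[mu]_x g x.
Proof.
move=> Hf Hg; have If := bounded_mfun_integrable mu _ _ Hf.
have Ig := bounded_mfun_integrable mu _ _ Hg.
rewrite RintegralD ?RintegralZl//.
by have := integrableZl measurableT a If; apply: eq_integrable.
Qed.

Lemma Rintegral_indic (mu : probability T R) (A : set T) : measurable A ->
  \int[mu]_x \1_A x = fine (mu A).
Proof. by move=> mA; rewrite /Rintegral integral_indic// setIT. Qed.

Lemma Rintegral_bounded_le (mu : probability T R) C f :
  bounded_mfun C f -> `|\int[mu]_x f x| <= C.
Proof.
move=> Hf; have If := bounded_mfun_integrable mu _ _ Hf.
apply: (le_trans (le_normr_Rintegral _ If)) => //.
have -> : C = \int[mu]_x C.
  by rewrite Rintegral_cst// [X in fine X](probability_setT mu) mulr1.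
apply: le_Rintegral => //.
- by have := integrable_norm If.
- by have := bounded_mfun_integrable mu _ _ (bounded_mfun_cst C).
- by move=> t _; exact: Hf.2.
Qed.

(** Since [x <= N], the sum counts all positive integers up to [x]: it is the integer part of
    [x]. *)
Lemma truncation_sum_near (x : R) (N : nat) : 0 <= x -> x <= N%:R ->
  `|x - \sum_(k < N) (k.+1%:R <= x)%R%:R| <= 1.
Proof.
move=> x0; elim: N => [|N IH] xN.
  by rewrite big_ord0 (_ : x = 0) ?subr0 ?normr0//; apply/eqP; rewrite eq_le xN.
have [xN'|Nx] := leP x N%:R.
  rewrite big_ord_recr/= (_ : (N.+1%:R <= x) = false) ?addr0; first exact: IH.
  by apply/negbTE; rewrite -ltNge (le_lt_trans xN')// ltr_nat.
have Hs : \sum_(k < N) (k.+1%:R <= x)%R%:R = N%:R :> R.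
  rewrite (eq_bigr (fun=> 1)) ?sumr_const ?card_ord// => i _.
  by rewrite (_ : _ <= _)// (le_trans _ (ltW Nx))// ler_nat.
rewrite big_ord_recr/= Hs ler_norml; move: xN Nx; rewrite -natr1.
by case: (leP (N%:R + 1) x) => /=; lra.
Qed.

(* Uniform approximation of a nonnegative function by a sum of indicators of
   its superlevel sets has error at most 1; rescaling makes it negligible. *)
Lemma bounded_functional_eq0 (F : (T -> R) -> R) (K : R) :
  (forall (a : R) C D f g, bounded_mfun C f -> bounded_mfun D g ->
     F (fun x => a * f x + g x) = a * F f + F g) ->
  (forall C f, bounded_mfun C f -> `|F f| <= K * C) ->
  (forall A, measurable A -> F (\1_A) = 0) ->
  forall C f, bounded_mfun C f -> F f = 0.
Proof.
move=> Flin Fbd F1.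
have F0 : F (cst 0) = 0 by have := F1 _ measurable0; rewrite indic0.
have Fc c : F (cst c) = 0.
  have := Flin c _ _ _ _ (bounded_mfun_indic _ measurableT) (bounded_mfun_cst 0).
  rewrite F1// F0 mulr0 addr0 => <-; congr F; apply/funext => x /=.
  by rewrite indicT /= mulr1 addr0.
(* The bound does not involve [C]: subtracting the truncation sum, on which [F] vanishes, leaves a
   function bounded by 1. *)
have Fge0 C f : bounded_mfun C f -> (forall t, 0 <= f t) -> `|F f| <= K.
  move=> Hf f0; pose A k := [set t | k.+1%:R <= f t].
  have mA k : measurable (A k).
    have -> : A k = f @^-1` `[k.+1%:R, +oo[%classic.
      by apply/seteqP; split=> t /=; rewrite in_itv /= ?andbT.
    by rewrite -[X in measurable X]setTI; apply: Hf.1 => //; exact: measurable_itv.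
  pose s n t : R := \sum_(k < n) \1_(A k) t.
  have Hs n : bounded_mfun n%:R (s n) /\ F (s n) = 0.
    elim: n => [|n [IH1 IH2]].
      rewrite /s; under eq_fun do rewrite big_ord0; split=> //.
      by split=> // t; rewrite normr0.
    have -> : s n.+1 = (fun t => 1 * \1_(A n) t + s n t).
      by apply/funext => t; rewrite /s big_ord_recr/= mul1r addrC.
    have H1 := bounded_mfun_indic _ (mA n).
    rewrite (Flin _ _ _ _ _ H1 IH1) IH2 F1// mulr0 addr0; split=> //.
    by have := bounded_mfun_lin 1 _ _ _ _ H1 IH1; rewrite normr1 mulr1 nat1r.
  pose N := Num.bound C.
  have CN : C <= N%:R by rewrite ltW// archi_boundP// (bounded_mfun_ge0 _ _ Hf).
  have [Hs1 Hs2] := Hs N.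
  have := Flin (-1) _ _ _ _ Hs1 Hf; rewrite Hs2 mulr0 add0r => <-.
  rewrite -[leRHS]mulr1; apply: Fbd; split=> [|t].
    by have [] := bounded_mfun_lin (-1) _ _ _ _ Hs1 Hf.
  rewrite addrC mulN1r.
  have -> : s N t = \sum_(k < N) (k.+1%:R <= f t)%R%:R.
    apply: eq_bigr => k _; rewrite indicE; congr (nat_of_bool _)%:R.
    by apply/idP/idP; rewrite inE.
  apply: truncation_sum_near => //.
  by rewrite (le_trans _ CN)// (le_trans (ler_norm _))//; exact: Hf.2.
move=> C f Hf.
(* Adding [C] makes [f] nonnegative without changing [F f], as [F] kills constants. *)
pose g t := 1 * f t + C.
have Hg : bounded_mfun (`|1| * C + `|C|) g :=
  bounded_mfun_lin 1 _ _ _ _ Hf (bounded_mfun_cst C).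
have g0 t : 0 <= g t.
  by have := Hf.2 t; rewrite /g ler_norml mul1r => /andP[+ _]; lra.
have Fg : F g = F f.
  by rewrite (Flin 1 _ _ _ _ Hf (bounded_mfun_cst C)) Fc mul1r addr0.
(* All multiples of [g] by naturals are nonnegative, so one [K] bounds [F] on each of them; the
   Archimedean property then forces [F g = 0]. *)
have FN (n : nat) : n%:R * `|F g| <= K.
  have := Flin n%:R _ _ _ _ Hg (bounded_mfun_cst 0).
  rewrite F0 addr0 -[X in X * `|_|]ger0_norm// -normrM => <-.
  apply: Fge0; first exact: bounded_mfun_lin Hg (bounded_mfun_cst 0).
  by move=> t; rewrite addr0 mulr_ge0.
rewrite -Fg; apply/eqP; rewrite -normr_eq0; apply/eqP/le_anti; rewrite normr_ge0 andbT.
rewrite leNgt; apply/negP => F_gt0.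
have K0 : 0 <= K by have := FN 0; rewrite mul0r.
have := FN (Num.bound (K / `|F g|)); apply/negP; rewrite -ltNge -ltr_pdivrMr//.
by apply: archi_boundP; rewrite divr_ge0.
Qed.

End bounded_measurable.

(** * Ergodicity of abstract operators with a Doeblin minorization *)

Section doeblin.
Context {d : measure_display} {T : measurableType d} {R : realType}.
Implicit Types (P : (T -> R) -> T -> R) (e : (T -> R) -> R) (f g : T -> R).

(** A Markov operator given by its action on functions: continuity under bounded pointwise
    convergence stands in for sigma-additivity of a kernel. The functional [e] acts as integration
    against a minorizing measure of total mass [beta], the same for all starting points. *)
Record doeblin_operator P e (beta : R) : Prop := DoeblinOperator {
  doeblin_measurable : forall C f, bounded_mfun C f -> measurable_fun setT (P f) ;
  doeblin_lin : forall (a : R) C D f g, bounded_mfun C f -> bounded_mfun D g ->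
    forall t, P (fun x => a * f x + g x) t = a * P f t + P g t ;
  doeblin_cst : forall c t, P (cst c) t = c ;
  doeblin_cvg : forall C (f_ : nat -> T -> R) f,
    (forall n, bounded_mfun C (f_ n)) -> bounded_mfun C f ->
    (forall t, f_ n t @[n --> \oo] --> f t) ->
    forall t, P (f_ n) t @[n --> \oo] --> P f t ;
  doeblin_rate : 0 < beta < 1 ;
  doeblin_minor_add : forall C D f g, bounded_mfun C f -> bounded_mfun D g ->
    e (fun x => f x + g x) = e f + e g ;
  doeblin_minor_cst : forall c, e (cst c) = beta * c ;
  doeblin_minor_ge0 : forall f, (forall t, 0 <= f t) -> 0 <= e f ;
  doeblin_minor_le : forall C f, bounded_mfun C f -> (forall t, 0 <= f t) ->
    forall t, e f <= P f t }.

(* The constant to which the functions [iter n P f] contract. *)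
Definition stationary_mean P f :=
  sup [set a | exists n, forall t, a <= iter n P f t].

Variables (P : (T -> R) -> T -> R) (e : (T -> R) -> R) (beta : R).
Hypothesis PD : doeblin_operator P e beta.
Local Notation L := (stationary_mean P).

Let rho := 1 - beta.

Let rho_gt0 : 0 < rho.
Proof. by have := doeblin_rate _ _ _ PD; rewrite /rho; lra. Qed.

Let rho_lt1 : rho < 1.
Proof. by have := doeblin_rate _ _ _ PD; rewrite /rho; lra. Qed.

Let cvg_rho (C : R) : rho ^+ n * (2 * C) @[n --> \oo] --> (0 : R).
Proof.
rewrite -[X in _ --> X](mul0r (2 * C)); apply: cvgMl.
by apply: cvg_expr; rewrite gtr0_norm.
Qed.

(** The minorization is applied to the nonnegative functions [f - a] and [b - f]. Each moves one end
    of the range inward by its value under [e], and these two values add up to [beta * (b - a)]. *)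
Lemma doeblin_oscillation C f (a b : R) :
  bounded_mfun C f -> (forall t, a <= f t <= b) ->
  exists a' b', [/\ a <= a', b' <= b, forall t, a' <= P f t <= b' &
                  b' - a' = (1 - beta) * (b - a)].
Proof.
move=> Hf fab.
pose u x := 1 * f x + cst (- a) x; pose v x := (-1) * f x + cst b x.
have Hu := bounded_mfun_lin 1 _ _ _ _ Hf (bounded_mfun_cst (- a)).
have Hv := bounded_mfun_lin (-1) _ _ _ _ Hf (bounded_mfun_cst b).
have u0 t : 0 <= u t by have := fab t; rewrite /u /=; lra.
have v0 t : 0 <= v t by have := fab t; rewrite /v /=; lra.
have eu0 := doeblin_minor_ge0 _ _ _ PD _ u0.
have ev0 := doeblin_minor_ge0 _ _ _ PD _ v0.
have euv : e u + e v = beta * (b - a).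
  rewrite -(doeblin_minor_add _ _ _ PD _ _ _ _ Hu Hv) -(doeblin_minor_cst _ _ _ PD).
  by congr e; apply/funext => x; rewrite /u /v /=; ring.
exists (a + e u), (b - e v); split; [lra|lra| |lra].
move=> t; have := doeblin_minor_le _ _ _ PD _ _ Hu u0 t.
have := doeblin_minor_le _ _ _ PD _ _ Hv v0 t.
rewrite (doeblin_lin _ _ _ PD _ _ _ _ _ Hf (bounded_mfun_cst _)) (doeblin_cst _ _ _ PD).
rewrite (doeblin_lin _ _ _ PD _ _ _ _ _ Hf (bounded_mfun_cst _)) (doeblin_cst _ _ _ PD).
lra.
Qed.

Lemma doeblin_bounded C f : bounded_mfun C f -> bounded_mfun C (P f).
Proof.
move=> Hf; split; first exact: (doeblin_measurable _ _ _ PD) Hf.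
have [t|a' [b' [? ? Pf _]] t] := doeblin_oscillation C f (- C) C Hf.
  by rewrite -ler_norml; exact: Hf.2.
by rewrite ler_norml; have := Pf t; lra.
Qed.

Lemma iter_doeblin_bounded n C f : bounded_mfun C f -> bounded_mfun C (iter n P f).
Proof. by move=> Hf; elim: n => //= n; exact: doeblin_bounded. Qed.

Lemma iter_doeblin_range n C f (a b : R) :
  bounded_mfun C f -> (forall t, a <= f t <= b) ->
  forall t, a <= iter n P f t <= b.
Proof.
move=> Hf fab; elim: n => //= n IH t.
have [a' [b' [? ? Pf _]]] :=
  doeblin_oscillation _ _ _ _ (iter_doeblin_bounded n _ _ Hf) IH.
by have := Pf t; lra.
Qed.

Lemma iter_doeblin_oscillation n C f : bounded_mfun C f ->
  exists a b, (forall t, a <= iter n P f t <= b) /\ b - a = rho ^+ n * (2 * C).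
Proof.
move=> Hf; elim: n => [|n [a [b [fab ab]]]].
  exists (- C), C; split; last by ring.
  by move=> t; rewrite -ler_norml; exact: Hf.2.
have [a' [b' [_ _ Pf ab']]] :=
  doeblin_oscillation _ _ _ _ (iter_doeblin_bounded n _ _ Hf) fab.
by exists a', b'; split=> //; rewrite ab' ab exprS mulrA.
Qed.

(** A lower bound of the [m]-th iterate and an upper bound of the [n]-th both persist under further
    steps, so they can be compared at the iterate [n + m]. Hence [b] bounds the whole set whose
    supremum is [L f]. *)
Lemma stationary_mean_between n C f (a b : R) : bounded_mfun C f ->
  (forall t, a <= iter n P f t <= b) -> a <= L f <= b.
Proof.
move=> Hf fab.
have ubb : ubound [set a | exists n, forall t, a <= iter n P f t] b.
  move=> a' [m a'f].
  have := iter_doeblin_range m _ _ _ _ (iter_doeblin_bounded n _ _ Hf) fab point.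
  have Hm t : a' <= iter m P f t <= C.
    by rewrite a'f (le_trans (ler_norm _))//; exact: (iter_doeblin_bounded m _ _ Hf).2.
  have := iter_doeblin_range n _ _ _ _ (iter_doeblin_bounded m _ _ Hf) Hm point.
  by rewrite -!iterD addnC; lra.
have Sa : [set a | exists n, forall t, a <= iter n P f t] a.
  by exists n => t; have /andP[] := fab t.
apply/andP; split; last by apply: ge_sup => //; exists a.
by apply: ub_le_sup => //; exists b.
Qed.

(** Both terms lie in the interval supplied by [iter_doeblin_oscillation]. *)
Lemma dist_iter_stationary_mean n C f t : bounded_mfun C f ->
  `|iter n P f t - L f| <= rho ^+ n * (2 * C).
Proof.
move=> Hf; have [a [b [fab <-]]] := iter_doeblin_oscillation n _ _ Hf.
have := stationary_mean_between _ _ _ _ _ Hf fab.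
by rewrite ler_norml; have := fab t; lra.
Qed.

Lemma cvg_iter_stationary_mean C f t : bounded_mfun C f ->
  iter n P f t @[n --> \oo] --> L f.
Proof.
move=> Hf; apply/cvgrPdist_lt => eps eps0.
have /cvgr0_norm_lt/(_ _ eps0) := cvg_rho C; apply: filterS => n.
apply: le_lt_trans; rewrite distrC (le_trans (dist_iter_stationary_mean n _ _ t Hf))//.
exact: ler_norm.
Qed.

Lemma iter_doeblin_lin n (a : R) C D f g : bounded_mfun C f -> bounded_mfun D g ->
  iter n P (fun x => a * f x + g x) = (fun x => a * iter n P f x + iter n P g x).
Proof.
move=> Hf Hg; elim: n => //= n ->; apply/funext => t.
exact: (doeblin_lin _ _ _ PD _ _ _ _ _ (iter_doeblin_bounded n _ _ Hf)
  (iter_doeblin_bounded n _ _ Hg)).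
Qed.

Lemma stationary_mean_lin (a : R) C D f g : bounded_mfun C f -> bounded_mfun D g ->
  L (fun x => a * f x + g x) = a * L f + L g.
Proof.
move=> Hf Hg.
have H := cvg_iter_stationary_mean _ _ point (bounded_mfun_lin a _ _ _ _ Hf Hg).
apply: (cvg_unique _ H) => //.
rewrite (_ : (fun n => _) =
    fun n => a * iter n P f point + iter n P g point); last first.
  by apply/funext => n; rewrite (iter_doeblin_lin n a _ _ _ _ Hf Hg).
apply: cvgD; last exact: cvg_iter_stationary_mean Hg.
by apply: cvgMr; exact: cvg_iter_stationary_mean Hf.
Qed.

Lemma stationary_mean_le C f : bounded_mfun C f -> `|L f| <= C.
Proof.
move=> Hf; rewrite ler_norml; apply: (stationary_mean_between 0 C f) => // t.
by rewrite /= -ler_norml; exact: Hf.2.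
Qed.

Lemma stationary_mean_ge0 C f : bounded_mfun C f -> (forall t, 0 <= f t) -> 0 <= L f.
Proof.
move=> Hf f0; suff /andP[] : 0 <= L f <= C by [].
apply: (stationary_mean_between 0 C f) => // t.
by rewrite /= f0 (le_trans (ler_norm _))//; exact: Hf.2.
Qed.

Lemma stationary_mean_cst c : L (cst c) = c.
Proof.
suff /andP[? ?] : c <= L (cst c) <= c by apply/le_anti/andP.
apply: (stationary_mean_between 0) (bounded_mfun_cst c) _ => t /=.
by rewrite lexx.
Qed.

(** The iterates of [P f] are those of [f] shifted by one. This becomes the invariance of the limit
    measure. *)
Lemma stationary_mean_step C f : bounded_mfun C f -> L (P f) = L f.
Proof.
move=> Hf.
have H := cvg_iter_stationary_mean _ _ point (doeblin_bounded _ _ Hf).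
apply: (cvg_unique _ H) => //.
have := cvg_iter_stationary_mean _ _ point Hf.
rewrite -(cvg_shiftS (fun n => iter n P f point)).
by under eq_fun do rewrite iterSr.
Qed.

Lemma iter_doeblin_cvg n C (f_ : nat -> T -> R) f :
  (forall k, bounded_mfun C (f_ k)) -> bounded_mfun C f ->
  (forall t, f_ k t @[k --> \oo] --> f t) ->
  forall t, iter n P (f_ k) t @[k --> \oo] --> iter n P f t.
Proof.
move=> Hf_ Hf f_f; elim: n => //= n IH.
apply: (doeblin_cvg _ _ _ PD C) => // [k|]; exact: iter_doeblin_bounded.
Qed.

(** The functions share the bound [C], so one [N] brings the [N]-th iterate within [eps / 3] of its
    mean for all of them at once; the [N]-step operator is itself continuous under bounded pointwise
    convergence. *)
Lemma stationary_mean_cvg C (f_ : nat -> T -> R) f :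
  (forall k, bounded_mfun C (f_ k)) -> bounded_mfun C f ->
  (forall t, f_ k t @[k --> \oo] --> f t) -> L (f_ k) @[k --> \oo] --> L f.
Proof.
move=> Hf_ Hf f_f; apply/cvgrPdist_lt => eps eps0.
have eps3 : 0 < eps / 3 by rewrite divr_gt0.
have [N HN] : exists N, rho ^+ N * (2 * C) < eps / 3.
  have /cvgr0_norm_lt/(_ _ eps3)[N _ HN] := cvg_rho C; exists N.
  exact: le_lt_trans (ler_norm _) (HN N (leqnn N)).
have /cvgrPdist_lt/(_ _ eps3) := iter_doeblin_cvg N _ _ _ Hf_ Hf f_f point.
apply: filterS => k; rewrite !ltr_norml.
have := dist_iter_stationary_mean N _ _ point Hf.
have := dist_iter_stationary_mean N _ _ point (Hf_ k).
rewrite !ler_norml; move: HN; set X := rho ^+ N * _; set Y := iter N P f point.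
by set Z := iter N P (f_ k) point; lra.
Qed.

(* The absolute value only matters on non-measurable sets. *)
Let nu (A : set T) : \bar R := `|L (\1_A)|%:E.

Let nu0 : nu set0 = 0%E.
Proof. by rewrite /nu indic0 (stationary_mean_cst 0) normr0. Qed.

Let nu_ge0 A : (0 <= nu A)%E.
Proof. by rewrite lee_fin. Qed.

Let nuE A : measurable A -> nu A = (L (\1_A))%:E.
Proof.
move=> mA; rewrite /nu ger0_norm//.
exact: stationary_mean_ge0 (bounded_mfun_indic _ mA) _.
Qed.

(** At each point the indicators of the finite unions are eventually equal to that of the full
    union, so finite additivity passes to the limit by [stationary_mean_cvg]. *)
Let nu_sigma_additive : semi_sigma_additive nu.
Proof.
move=> F mF tF mUF.
pose G n := \big[setU/set0]_(i < n) F i.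
have mG n : measurable (G n) by exact: bigsetU_measurable.
have sumE n : (\sum_(0 <= i < n) nu (F i))%E = (L (\1_(G n)))%:E.
  elim: n => [|n IH].
    by rewrite big_geq// /G big_ord0 indic0 (stationary_mean_cst 0).
  rewrite big_nat_recr//= IH nuE// -EFinD; congr EFin.
  rewrite -[L (\1_(G n))]mul1r.
  rewrite -(stationary_mean_lin 1 _ _ _ _ (bounded_mfun_indic _ (mG n))
    (bounded_mfun_indic _ (mF n))).
  congr L; apply/funext => x; rewrite mul1r /G big_ord_recr/= !indicE in_setU.
  case: (boolP (x \in F n)) => xF; last by rewrite orbF addr0.
  case: (boolP (x \in \big[setU/set0]_(i < n) F i)) => [|_]; last by rewrite add0r.
  rewrite inE -bigcup_mkord => -[i /= ilt Fix]; move: xF; rewrite inE => Fnx.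
  move/trivIsetP: tF => /(_ i n Logic.I Logic.I); rewrite (ltn_eqF ilt) => /(_ isT).
  by move/seteqP => [/(_ x)] /(_ (conj Fix Fnx)).
rewrite nuE//; under eq_fun do rewrite sumE.
apply/cvg_EFin; first exact: nearW.
apply: (stationary_mean_cvg 1) => [k| |t].
- exact: bounded_mfun_indic.
- exact: bounded_mfun_indic.
- rewrite indicE; have [|tF'] := boolP (t \in \bigcup_n F n).
    rewrite inE => -[m _ Fmt]; apply: cvg_near_cst; exists m.+1 => // k /= mk.
    by apply/eqP; rewrite indicE mem_set//= /G -bigcup_mkord; exists m.
  apply: cvg_near_cst; apply: nearW => k; rewrite indicE memNset// => Gt.
  move/negP: tF'; apply; rewrite inE.
  by move: Gt; rewrite /G -bigcup_mkord => -[m _ ?]; exists m.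
Qed.

Theorem doeblin_ergodic : exists nu : probability T R,
  [/\ (forall A, measurable A -> nu A = (\int[nu]_t (P (\1_A) t)%:E)%E),
      (forall nu' : probability T R,
        (forall A, measurable A -> nu' A = (\int[nu']_t (P (\1_A) t)%:E)%E) ->
        forall A, measurable A -> nu' A = nu A) &
      forall C f t n, bounded_mfun C f ->
        `|iter n P f t - \int[nu]_x f x| <= (1 - beta) ^+ n * (2 * C)].
Proof.
have [np npE] : exists np : probability T R,
    forall A, measurable A -> np A = (L (\1_A))%:E.
  pose m1 := isMeasure.Build _ _ _ nu nu0 nu_ge0 nu_sigma_additive.
  have nuT : nu setT = 1%E by rewrite nuE// indicT (stationary_mean_cst 1).
  pose nm : {measure set T -> \bar R} := HB.pack nu m1.
  pose m2 := Measure_isProbability.Build _ _ _ nm nuT.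
  by exists (HB.pack nu m1 m2 : probability T R).
(* Each functional is at most [C] on functions bounded by [C], whence [K = 2] for the difference,
   which vanishes on indicators by [npE]. *)
have intE C f : bounded_mfun C f -> \int[np]_x f x = L f.
  move=> Hf; apply/eqP; rewrite -subr_eq0; apply/eqP.
  apply: (bounded_functional_eq0 (fun f => \int[np]_x f x - L f) 2) Hf.
  - move=> a C1 D1 f1 g1 Hf1 Hg1.
    rewrite (Rintegral_bounded_lin np a _ _ _ _ Hf1 Hg1).
    by rewrite (stationary_mean_lin a _ _ _ _ Hf1 Hg1); ring.
  - move=> C1 f1 Hf1; rewrite (le_trans (ler_normB _ _))// mulr_natl mulr2n.
    by rewrite lerD ?(Rintegral_bounded_le np _ _ Hf1) ?(stationary_mean_le _ _ Hf1).
  - by move=> A mA; rewrite Rintegral_indic// npE//= subrr.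
have PI (A : set T) : measurable A -> bounded_mfun 1 (P (\1_A)).
  by move=> mA; exact: doeblin_bounded (bounded_mfun_indic _ mA).
have intP (nu' : probability T R) C f : bounded_mfun C f ->
    (\int[nu']_t (f t)%:E)%E = (\int[nu']_x f x)%:E.
  move=> Hf; rewrite /Rintegral fineK//.
  exact: integrable_fin_num (bounded_mfun_integrable nu' _ _ Hf).
exists np; split=> [A mA|nu' inv A mA|C f t n Hf].
- rewrite npE// (intP _ _ _ (PI _ mA)) (intE _ _ (PI _ mA)).
  by rewrite (stationary_mean_step _ _ (bounded_mfun_indic _ mA)).
(* Invariance is given on sets only, but iterates of an indicator need not be indicators; it is
   first extended to bounded measurable functions. *)
- have stepE C f : bounded_mfun C f -> \int[nu']_x P f x = \int[nu']_x f x.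
    move=> Hf; apply/eqP; rewrite -subr_eq0; apply/eqP.
    apply: (bounded_functional_eq0
      (fun f => \int[nu']_x P f x - \int[nu']_x f x) 2) Hf.
    + move=> a C1 D1 f1 g1 Hf1 Hg1.
      rewrite (Rintegral_bounded_lin nu' a _ _ _ _ Hf1 Hg1).
      under eq_Rintegral do rewrite (doeblin_lin _ _ _ PD a _ _ _ _ Hf1 Hg1).
      by rewrite (Rintegral_bounded_lin nu' a _ _ _ _ (doeblin_bounded _ _ Hf1)
        (doeblin_bounded _ _ Hg1)); ring.
    + move=> C1 f1 Hf1; rewrite (le_trans (ler_normB _ _))// mulr_natl mulr2n.
      by rewrite lerD// Rintegral_bounded_le//; exact: doeblin_bounded.
    + move=> B mB; rewrite Rintegral_indic// inv// (intP _ _ _ (PI _ mB)) /=.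
      exact: subrr.
  have iterE n : \int[nu']_x iter n P (\1_A) x = \int[nu']_x \1_A x.
    elim: n => //= n <-.
    exact: stepE (iter_doeblin_bounded n _ _ (bounded_mfun_indic _ mA)).
  rewrite npE// -[LHS]fineK ?fin_num_measure// -Rintegral_indic//; congr EFin.
  have HA : bounded_mfun 1 (\1_A : T -> R) := bounded_mfun_indic _ mA.
  (* By [iterE] the indicator may be replaced by its [n]-th iterate, which is uniformly close to the
     constant [L (\1_A)]. *)
  have dist n : `|\int[nu']_x \1_A x - L (\1_A)| <= rho ^+ n * (2 * 1).
    have HD := bounded_mfun_lin 1 _ _ _ _ (iter_doeblin_bounded n _ _ HA)
      (bounded_mfun_cst (- L (\1_A))).
    have HD' : bounded_mfun (rho ^+ n * (2 * 1))
        (fun x => 1 * iter n P (\1_A) x + cst (- L (\1_A)) x).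
      split; first exact: HD.1.
      by move=> t; rewrite mul1r; exact: dist_iter_stationary_mean.
    have := Rintegral_bounded_le nu' _ _ HD'.
    rewrite (Rintegral_bounded_lin nu' 1 _ _ _ _ (iter_doeblin_bounded n _ _ HA)
      (bounded_mfun_cst _)).
    by rewrite iterE Rintegral_cst// [X in fine X](probability_setT nu') mul1r !mulr1.
  apply/eqP; rewrite -subr_eq0 -normr_eq0; apply/eqP/le_anti; rewrite normr_ge0 andbT.
  by apply: (cvgr_to_ge (cvg_rho 1)); exact: nearW.
- by rewrite (intE _ _ Hf); exact: dist_iter_stationary_mean.
Qed.

End doeblin.

(** * Borel measurability on the product space *)

Section borel_product.
Context {R : realType} {V : normedModType R}.

Lemma measurable_borel_fst :
  measurable_fun setT (fst : borel (V * V)%type -> borel V).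
Proof.
apply: (@measurability _ _ (borel (V * V)%type) (borel V) setT fst (@open V))
  => // _ [B oB <-].
rewrite setTI; apply: sub_sigma_algebra.
by apply: open_comp => // x _; exact: cvg_fst.
Qed.

Lemma measurable_borel_snd :
  measurable_fun setT (snd : borel (V * V)%type -> borel V).
Proof.
apply: (@measurability _ _ (borel (V * V)%type) (borel V) setT snd (@open V))
  => // _ [B oB <-].
rewrite setTI; apply: sub_sigma_algebra.
by apply: open_comp => // x _; exact: cvg_snd.
Qed.

(* Separability makes every open set of the product a countable union of
   rectangles. *)
Lemma measurable_borel_pair {d : measure_display} {S : measurableType d}
    (g h : S -> borel V) :
  separable_space V -> measurable_fun setT g -> measurable_fun setT h ->
  measurable_fun setT ((fun s => (g s, h s)) : S -> borel (V * V)%type).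
Proof.
move=> [D [cD dD]] mg mh.
have [u Du] : exists u : nat -> V, forall x, D x -> exists n, u n = x.
  have /pfcard_geP[D0|/unsquash u] := cD.
    by exists (fun=> 0) => x; rewrite D0.
  by exists u => x /(@surj _ _ _ _ u)[n _ <-]; exists n.
have dense (x : V) (e : R) : 0 < e -> exists n, ball x e (u n).
  move=> e0; have : closure D x by rewrite dD.
  move=> /(_ _ (nbhsx_ballx x e e0))[y [/Du[n <-] xy]].
  by exists n.
apply: (@measurability _ _ S (borel (V * V)%type) setT (fun s => (g s, h s))
  (@open (V * V)%type)) => // _ [U oU <-]; rewrite setTI.
pose B (i n : nat) : set V := ball (u i) n.+1%:R^-1.
have mB i n : measurable (B i n : set (borel V)).
  by apply: sub_sigma_algebra; exact: ball_open.
(* [I] selects the pairs of balls of equal radius, centred in the dense sequence, whose product lies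
   in [U]. With [I p] placed inside [F p], the union can run over all triples. *)
pose I : set (nat * nat * nat) :=
  [set p | forall x y, B p.1.1 p.2 x -> B p.1.2 p.2 y -> U (x, y)].
pose F (p : nat * nat * nat) := [set s | I p /\ B p.1.1 p.2 (g s) /\ B p.1.2 p.2 (h s)].
have -> : (fun s => (g s, h s)) @^-1` U = \bigcup_p F p.
  apply/seteqP; split=> [s /= Us|s [p _ [Ip [Bg Bh]]]]; last exact: Ip.
  have /nbhs_ballP[e /= e0 eU] : nbhs (g s, h s) U by exact: open_nbhs_nbhs.
  (* Two radii must fit into [e]: one from [g s] to the centre [u i], one from there to any point of
     the ball. *)
  have [n ne] : exists n, (n.+1%:R^-1 : R) + n.+1%:R^-1 <= e.
    have e2 : 0 < e / 2 by rewrite divr_gt0.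
    have [n _ /(_ n (leqnn n)) /= ne] := near_infty_natSinv_lt (PosNum e2).
    by exists n; rewrite (splitr e) lerD// ltW.
  have n0 : 0 < n.+1%:R^-1 :> R by rewrite invr_gt0.
  have [i Hi] := dense (g s) _ n0; have [j Hj] := dense (h s) _ n0.
  exists (i, j, n) => //; split; last by split; exact: ball_sym.
  move=> x y /= Bx By; apply: eU; split => /=.
    exact: le_ball ne _ (ball_triangle Hi Bx).
  exact: le_ball ne _ (ball_triangle Hj By).
apply: countable_bigcupT_measurable => // p.
have [Ip|nIp] := pselect (I p).
  have -> : F p = (setT `&` g @^-1` B p.1.1 p.2) `&` (setT `&` h @^-1` B p.1.2 p.2).
    by apply/seteqP; split=> s /=; rewrite /F /=; tauto.
  by apply: measurableI; [exact: mg|exact: mh].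
rewrite (_ : F p = set0)//; apply/seteqP; split=> s //= [].
by move/nIp.
Qed.

End borel_product.

(** * Auxiliary facts on measurability, integrals and density ratios *)

Lemma measurable_fun_invr_ge0 {d : measure_display} {S : measurableType d}
    {R : realType} (f : S -> R) : (forall s, 0 <= f s) ->
  measurable_fun setT f -> measurable_fun setT (fun s => (f s)^-1).
Proof.
move=> f0 mf; rewrite (_ : (fun s => _) = (@powR R ^~ (-1)) \o f).
  by apply: measurableT_comp => //; exact: measurable_powR.
by apply/funext => s /=; rewrite powR_inv1.
Qed.

Lemma bounded_mulr_integrable {d : measure_display} {T : measurableType d}
    {R : realType} (mu : {measure set T -> \bar R}) (C : R) (f w : T -> R) :
  bounded_mfun C f -> (forall t, 0 <= w t) -> mu.-integrable setT (EFin \o w) ->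
  mu.-integrable setT (EFin \o (fun t => f t * w t)).
Proof.
move=> [mf fC] w0 iw.
have mw : measurable_fun setT w by apply/measurable_EFinP; exact: measurable_int iw.
apply: (@le_integrable _ _ _ _ _ measurableT _ (fun t => C%:E * (w t)%:E)%E).
- by apply/measurable_EFinP; exact: measurable_funM.
- move=> t _ /=; rewrite lee_fin normrM normrM (ger0_norm (w0 t)) ler_wpM2r//.
  exact: le_trans (fC t) (ler_norm _).
- exact: integrableZl.
Qed.

(** A zero integral would make [w] vanish almost everywhere, so the whole space, of mass 1, would be
    a null set. *)
Lemma Rintegral_gt0 {d : measure_display} {T : measurableType d}
    {R : realType} (mu : probability T R) (w : T -> R) :
  (forall t, 0 < w t) -> mu.-integrable setT (EFin \o w) -> 0 < \int[mu]_t w t.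
Proof.
move=> w0 iw; rewrite lt_neqAle Rintegral_ge0 ?andbT; last by move=> t _; exact: ltW.
apply/negP => /eqP w_0.
have : (\int[mu]_x `|(w x)%:E| = 0)%E.
  rewrite (eq_integral (EFin \o w)); last by move=> t _ /=; rewrite gtr0_norm.
  by rewrite -(fineK (integrable_fin_num measurableT iw)) [X in X%:E](esym w_0).
move/(ae_eq_integral_abs mu measurableT (measurable_int _ iw)) => [N [mN N0 wN]].
have : (mu setT <= mu N)%E.
  apply: le_measure; rewrite ?inE// => t _; apply: wN => /= /(_ Logic.I).
  by move=> [] wt; have := w0 t; rewrite wt ltxx.
by rewrite N0 [X in (X <= _)%E](probability_setT mu) lee_fin ler10.
Qed.

(** On the compact sublevel set the continuous ratio [p / q] is bounded; off it [p < q]. *)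
Lemma compact_sublevel_ratio_bound {R : realType} {V : normedModType R}
    (p q : V -> R) :
  continuous p -> continuous q -> (forall z, 0 < p z) -> (forall z, 0 < q z) ->
  compact [set z | q z / p z <= 1] ->
  exists2 M, 1 <= M & forall z, p z <= M * q z.
Proof.
move=> cp cq p0 q0 cK.
have cpq : continuous (fun z => p z / q z).
  by move=> z; apply: cvgM; [exact: cp|apply: cvgV; [rewrite gt_eqF|exact: cq]].
have := compact_bounded (continuous_compact (continuous_subspaceT cpq) cK).
move=> [M [_ HM]]; exists (Num.max 1 (M + 1)); first by rewrite le_max lexx.
move=> z; rewrite -ler_pdivrMr//.
have [qp|pq] := leP (q z / p z) 1.
  rewrite le_max; apply/orP; right; rewrite (le_trans (ler_norm _))//.
  by apply: (HM (M + 1)); [lra|exists z].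
rewrite le_max; apply/orP; left; rewrite ler_pdivrMr// mul1r.
by move: pq; rewrite ltr_pdivlMr// mul1r => /ltW.
Qed.

(** * The acceptance probability of a single chain *)

Section acceptance.
Context {R : realType} {V : normedModType R}.
Variables p q : V -> R.
Hypotheses (p_gt0 : forall z, 0 < p z) (q_gt0 : forall z, 0 < q z).

Lemma alpha_ge0 x z : 0 <= alpha p q x z.
Proof. by rewrite le_min ler01 ltW// divr_gt0// mulr_gt0. Qed.

Lemma alpha_le1 x z : alpha p q x z <= 1.
Proof. by rewrite ge_min lexx. Qed.

(** The domination is used at [z] when the minimum is 1, and at [x] otherwise, where the right-hand
    side is [p z * q x / p x]. *)
Lemma alpha_minor (M : R) x z : 0 < M -> (forall y, p y <= M * q y) ->
  p z / M <= alpha p q x z * q z.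
Proof.
move=> M0 pMq; rewrite /alpha; have [_|_] := leP 1 (p z * q x / (p x * q z)).
  by rewrite mul1r ler_pdivrMr// mulrC.
rewrite ler_pdivrMr//.
have -> : p z * q x / (p x * q z) * q z * M = p z * (M * q x / p x).
  by field; rewrite !gt_eqF.
by apply: ler_peMr; rewrite ?ler_pdivlMr// ?mul1r// ltW.
Qed.

Lemma measurable_alpha {d : measure_display} {S : measurableType d}
    (g h : S -> borel V) :
  measurable_fun setT (p : borel V -> R) -> measurable_fun setT (q : borel V -> R) ->
  measurable_fun setT g -> measurable_fun setT h ->
  measurable_fun setT (fun s => alpha p q (g s) (h s)).
Proof.
move=> mp mq mg mh.
have mc (r : borel V -> R) (k : S -> borel V) : measurable_fun setT r ->
    measurable_fun setT k -> measurable_fun setT (fun s => r (k s)).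
  by move=> mr mk; exact: measurableT_comp mr mk.
apply: measurable_minr => //; apply: measurable_funM.
  by apply: measurable_funM; exact: mc.
apply: measurable_fun_invr_ge0; first by move=> s; rewrite ltW// mulr_gt0.
by apply: measurable_funM; exact: mc.
Qed.

End acceptance.

(** * The coupled kernel as a Doeblin operator *)

Section coupled_kernel.
Context {R : realType} {V : normedModType R}.
Variables (mu : probability (borel V) R) (pa pb Q : V -> R).
Hypotheses (Vsep : separable_space V).
Hypotheses (Da : is_density mu pa) (Db : is_density mu pb) (DQ : is_density mu Q).
Hypotheses (pa_gt0 : forall z, 0 < pa z) (pb_gt0 : forall z, 0 < pb z).
Hypothesis Q_gt0 : forall z, 0 < Q z.
Implicit Types (f g : borel (V * V)%type -> R) (t : V * V).

Local Notation P := (Pop mu pa pb Q).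

(* For a fixed proposal [z], the expectation of [f] over the accept/reject
   decision. *)
Definition coupled_mix f t z : R :=
  let a := alpha pa Q t.1 z in let b := alpha pb Q t.2 z in
  Num.min a b * f (z, z) + Num.max 0 (a - b) * f (z, t.2)
  + Num.max 0 (b - a) * f (t.1, z) + (1 - Num.max a b) * f t.

(** With a shared uniform number these are the probabilities that both chains accept, only the
    first, only the second, or (one minus the maximum) neither. *)
Lemma coupled_weights t z :
  let a := alpha pa Q t.1 z in let b := alpha pb Q t.2 z in
  [/\ 0 <= Num.min a b <= 1, 0 <= Num.max 0 (a - b) <= 1,
      0 <= Num.max 0 (b - a) <= 1, 0 <= Num.max a b <= 1 &
      Num.min a b + Num.max 0 (a - b) + Num.max 0 (b - a) + (1 - Num.max a b) = 1].
Proof.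
move=> a b.
have a0 : 0 <= a by exact: alpha_ge0.
have b0 : 0 <= b by exact: alpha_ge0.
have a1 : a <= 1 by exact: alpha_le1.
have b1 : b <= 1 by exact: alpha_le1.
have [ab|ba] := leP a b.
  have -> : Num.max 0 (a - b) = 0 by apply/max_idPl; lra.
  have -> : Num.max 0 (b - a) = b - a by apply/max_idPr; lra.
  by split; lra.
have -> : Num.max 0 (a - b) = a - b by apply/max_idPr; lra.
have -> : Num.max 0 (b - a) = 0 by apply/max_idPl; lra.
by split; lra.
Qed.

Lemma coupled_mix_le C f t z : (forall x, `|f x| <= C) -> `|coupled_mix f t z| <= C.
Proof.
move=> fC; rewrite /coupled_mix /=; have [] := coupled_weights t z.
set w1 := Num.min _ _; set w2 := Num.max 0 _; set w3 := Num.max 0 _.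
set w4 := Num.max _ _; move=> /andP[w1_0 _] /andP[w2_0 _] /andP[w3_0 _] /andP[_ w4_1] wE.
have w4_0 : 0 <= 1 - w4 by rewrite subr_ge0.
have H w x : 0 <= w -> `|w * f x| <= w * C.
  by move=> w0; rewrite normrM ger0_norm// ler_wpM2l.
have -> : C = w1 * C + w2 * C + w3 * C + (1 - w4) * C by rewrite -!mulrDl wE mul1r.
by do 3! (apply: (le_trans (ler_normD _ _)); apply: lerD; last exact: H); exact: H.
Qed.

(** Only the event that both chains accept, and so meet on the diagonal, is kept; it yields the
    minorizing measure. *)
Lemma coupled_mix_ge f t z : (forall x, 0 <= f x) ->
  Num.min (alpha pa Q t.1 z) (alpha pb Q t.2 z) * f (z, z) <= coupled_mix f t z.
Proof.
move=> f0; rewrite /coupled_mix /=; have [] := coupled_weights t z.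
set w1 := Num.min _ _; set w2 := Num.max 0 _; set w3 := Num.max 0 _.
set w4 := Num.max _ _; move=> _ /andP[w2_0 _] /andP[w3_0 _] /andP[_ w4_1] _.
by rewrite -!addrA lerDl !addr_ge0 ?mulr_ge0// subr_ge0.
Qed.

Lemma coupled_mix_ge0 f t z : (forall x, 0 <= f x) -> 0 <= coupled_mix f t z.
Proof.
move=> f0; apply: le_trans (coupled_mix_ge f t z f0).
by rewrite mulr_ge0//; have [/andP[]] := coupled_weights t z.
Qed.

Lemma coupled_mix_lin (c : R) f g t z :
  coupled_mix (fun x => c * f x + g x) t z = c * coupled_mix f t z + coupled_mix g t z.
Proof. by rewrite /coupled_mix /=; ring. Qed.

Lemma coupled_mix_cst (c : R) t z : coupled_mix (cst c) t z = c.
Proof.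
rewrite /coupled_mix /=; have [_ _ _ _] := coupled_weights t z.
by rewrite -!mulrDl => ->; rewrite mul1r.
Qed.

(** General [g] and [h] cover both a fixed state with varying proposal and joint measurability in
    the two, required for Tonelli. *)
Lemma measurable_coupled_mix {d : measure_display} {S : measurableType d}
    (f : borel (V * V)%type -> R) (g : S -> borel (V * V)%type) (h : S -> borel V) :
  measurable_fun setT f -> measurable_fun setT g -> measurable_fun setT h ->
  measurable_fun setT (fun s => coupled_mix f (g s) (h s)).
Proof.
move=> mf mg mh.
have mg1 : measurable_fun setT ((fun s => (g s).1) : S -> borel V).
  exact: (measurableT_comp measurable_borel_fst mg).
have mg2 : measurable_fun setT ((fun s => (g s).2) : S -> borel V).
  exact: (measurableT_comp measurable_borel_snd mg).
have ma := measurable_alpha _ _ pa_gt0 Q_gt0 _ _ Da.2.1 DQ.2.1 mg1 mh.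
have mb := measurable_alpha _ _ pb_gt0 Q_gt0 _ _ Db.2.1 DQ.2.1 mg2 mh.
have mp (k1 k2 : S -> borel V) : measurable_fun setT k1 -> measurable_fun setT k2 ->
    measurable_fun setT (fun s => f (k1 s, k2 s)).
  move=> m1 m2; exact: (measurableT_comp mf (measurable_borel_pair _ _ Vsep m1 m2)).
apply: measurable_funD; last first.
  apply: measurable_funM; last exact: (measurableT_comp mf mg).
  by apply: measurable_funB => //; exact: measurable_maxr.
apply: measurable_funD; last first.
  apply: measurable_funM; last exact: mp.
  by apply: measurable_maxr => //; exact: measurable_funB.
apply: measurable_funD; last first.
  apply: measurable_funM; last exact: mp.
  by apply: measurable_maxr => //; exact: measurable_funB.
by apply: measurable_funM; [exact: measurable_minr|exact: mp].
Qed.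

Lemma density_integrable (w : V -> R) : is_density mu w ->
  mu.-integrable setT (EFin \o (w : borel V -> R)).
Proof.
move=> [w0 [mw w1]]; apply/integrableP; split; first exact/measurable_EFinP.
rewrite (eq_integral (fun z : borel V => (w z)%:E)).
  by rewrite w1 ltry.
by move=> z _ /=; rewrite ger0_norm.
Qed.

Lemma Rintegral_density (w : V -> R) : is_density mu w ->
  \int[mu]_z w z = 1.
Proof. by move=> [_ [_ w1]]; rewrite /Rintegral w1. Qed.

Lemma bounded_coupled_mix C f t : bounded_mfun C f ->
  bounded_mfun C (coupled_mix f t : borel V -> R).
Proof.
move=> [mf fC]; split=> [|z]; last exact: coupled_mix_le.
apply: (measurable_coupled_mix f (fun=> t : borel (V * V)%type)
  (fun z : borel V => z)) => //.
Qed.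

(** Writing the 1 of the rejection term as the integral of [Q] gives all four terms the weight
    [Q z], so they merge into one integral. *)
Lemma PopE C f t : bounded_mfun C f ->
  P f t = \int[mu]_z (coupled_mix f t z * Q z).
Proof.
move=> Hf; have [mf fC] := Hf.
have Q0 z : 0 <= Q z by exact: ltW.
have mt1 : measurable_fun setT ((fun=> t.1) : borel V -> borel V) by [].
have mt2 : measurable_fun setT ((fun=> t.2) : borel V -> borel V) by [].
have mid : measurable_fun setT ((fun z => z) : borel V -> borel V) by [].
have ma := measurable_alpha _ _ pa_gt0 Q_gt0 _ _ Da.2.1 DQ.2.1 mt1 mid.
have mb := measurable_alpha _ _ pb_gt0 Q_gt0 _ _ Db.2.1 DQ.2.1 mt2 mid.
have mp (k1 k2 : borel V -> borel V) : measurable_fun setT k1 ->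
    measurable_fun setT k2 -> measurable_fun setT (fun z => f (k1 z, k2 z)).
  move=> m1 m2; exact: (measurableT_comp mf (measurable_borel_pair _ _ Vsep m1 m2)).
have iQ := density_integrable _ DQ.
have HI (w : borel V -> R) (k : borel V -> borel (V * V)%type) :
    measurable_fun setT w -> (forall z, 0 <= w z <= 1) ->
    measurable_fun setT (fun z => f (k z)) ->
    mu.-integrable setT (EFin \o (fun z => w z * f (k z) * Q z)).
  move=> mw w01 mk; apply: (bounded_mulr_integrable _ C (fun z => w z * f (k z))) => //.
  split; first exact: measurable_funM.
  move=> z; have /andP[w0 w1] := w01 z; rewrite normrM ger0_norm//.
  by rewrite (le_trans _ (fC (k z)))// ler_piMl.
pose a z := alpha pa Q t.1 z; pose b z := alpha pb Q t.2 z.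
have I1 := HI (fun z => Num.min (a z) (b z)) (fun z => (z, z))
  (measurable_minr ma mb)
  (fun z => let: And5 h _ _ _ _ := coupled_weights t z in h) (mp _ _ mid mid).
have I2 := HI (fun z => Num.max 0 (a z - b z)) (fun z => (z, t.2))
  (measurable_maxr (measurable_cst _) (measurable_funB ma mb))
  (fun z => let: And5 _ h _ _ _ := coupled_weights t z in h) (mp _ _ mid mt2).
have I3 := HI (fun z => Num.max 0 (b z - a z)) (fun z => (t.1, z))
  (measurable_maxr (measurable_cst _) (measurable_funB mb ma))
  (fun z => let: And5 _ _ h _ _ := coupled_weights t z in h) (mp _ _ mt1 mid).
have I4 : mu.-integrable setT
    (EFin \o ((fun z => Num.max (a z) (b z) * Q z) : borel V -> R)).
  apply: (bounded_mulr_integrable _ 1 (fun z : borel V => Num.max (a z) (b z))) => //.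
  split; first exact: measurable_maxr.
  by move=> z; have [_ _ _ /andP[? ?] _] := coupled_weights t z; rewrite ger0_norm.
have I5 : mu.-integrable setT
    (EFin \o ((fun z => Q z - Num.max (a z) (b z) * Q z) : borel V -> R)).
  by have := integrableB measurableT iQ I4; apply: eq_integrable.
have I6 : mu.-integrable setT
    (EFin \o ((fun z => f t * (Q z - Num.max (a z) (b z) * Q z)) : borel V -> R)).
  by have := integrableZl measurableT (f t) I5; apply: eq_integrable.
have I12 := integrableD measurableT I1 I2.
have I123 := integrableD measurableT I12 I3.
rewrite /Pop -(Rintegral_density _ DQ) -RintegralB// -RintegralZl//.
rewrite -RintegralD// -RintegralD// -RintegralD//.
by apply: eq_Rintegral => z _; rewrite /coupled_mix /= /a /b; ring.
Qed.

Lemma coupled_mix_integrable C f t : bounded_mfun C f ->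
  mu.-integrable setT
    (EFin \o ((fun z => coupled_mix f t z * Q z) : borel V -> R)).
Proof.
move=> Hf; apply: (@bounded_mulr_integrable _ (borel V) _ mu C (coupled_mix f t) Q).
- exact: bounded_coupled_mix.
- by move=> z; exact: ltW.
- exact: density_integrable.
Qed.

Lemma Pop_lin (c : R) C D f g t : bounded_mfun C f -> bounded_mfun D g ->
  P (fun x => c * f x + g x) t = c * P f t + P g t.
Proof.
move=> Hf Hg; rewrite (PopE _ _ t (bounded_mfun_lin c _ _ _ _ Hf Hg)).
rewrite (PopE _ _ t Hf) (PopE _ _ t Hg).
have If := coupled_mix_integrable _ _ t Hf.
have Ig := coupled_mix_integrable _ _ t Hg.
rewrite -RintegralZl// -RintegralD//; last first.
  by have := integrableZl measurableT c If; apply: eq_integrable.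
by apply: eq_Rintegral => z _; rewrite coupled_mix_lin; ring.
Qed.

Lemma Pop_cst (c : R) t : P (cst c) t = c.
Proof.
rewrite (PopE _ _ t (bounded_mfun_cst c)).
under eq_Rintegral do rewrite coupled_mix_cst.
by rewrite RintegralZl ?Rintegral_density ?mulr1//; exact: density_integrable.
Qed.

Lemma Pop_measurable C f : bounded_mfun C f ->
  measurable_fun setT (P f : borel (V * V)%type -> R).
Proof.
move=> Hf.
(* Tonelli asks for a nonnegative integrand, so [f] is shifted up by [C]; this changes [P f] by the
   constant [C] only. *)
have Hg := bounded_mfun_lin 1 _ _ _ _ Hf (bounded_mfun_cst C).
set g := (fun x => _) in Hg.
have g0 x : 0 <= g x.
  by have := Hf.2 x; rewrite /g ler_norml mul1r => /andP[+ _] /=; lra.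
have -> : P f = (fun t => P g t - C).
  apply/funext => t; rewrite (Pop_lin _ _ _ _ _ t Hf (bounded_mfun_cst C)).
  by rewrite Pop_cst; ring.
apply: measurable_funB => //.
pose F (x : borel (V * V)%type * borel V) := (coupled_mix g x.1 x.2 * Q x.2)%:E.
have mF : measurable_fun setT F.
  apply/measurable_EFinP; apply: measurable_funM.
    by apply: measurable_coupled_mix => //; exact: Hg.1.
  exact: (measurableT_comp DQ.2.1 measurable_snd).
have F0 x : (0 <= F x)%E by rewrite lee_fin mulr_ge0 ?coupled_mix_ge0// ltW.
have := @measurable_fun_fubini_tonelli_F _ _ _ _ _ mu F mF F0.
move=> /(measurableT_comp (@fine_measurable R setT measurableT)).
by apply: eq_measurable_fun => t _; rewrite /= (PopE _ _ t Hg).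
Qed.

(** Dominated convergence with envelope [C * Q]; the weights of the mixture do not depend on [n]. *)
Lemma Pop_cvg C (f_ : nat -> borel (V * V)%type -> R) f :
  (forall n, bounded_mfun C (f_ n)) -> bounded_mfun C f ->
  (forall t, f_ n t @[n --> \oo] --> f t) ->
  forall t, P (f_ n) t @[n --> \oo] --> P f t.
Proof.
move=> Hf_ Hf f_f t; rewrite (PopE _ _ t Hf).
under eq_fun do rewrite (PopE _ _ t (Hf_ _)).
apply: fine_cvg; rewrite /Rintegral fineK; last first.
  exact: integrable_fin_num (coupled_mix_integrable _ _ t Hf).
apply: (@dominated_cvg _ (borel V) R mu setT measurableT
  (fun n z => (coupled_mix (f_ n) t z * Q z)%:E)
  (fun z => (coupled_mix f t z * Q z)%:E) (fun z => (C * Q z)%:E)) => //.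
- by move=> n; apply: measurable_int (coupled_mix_integrable _ _ t (Hf_ n)).
- move=> z _; apply/cvg_EFin; first exact: nearW.
  apply: cvgMl; rewrite /coupled_mix /=.
  by repeat apply: cvgD; apply: cvgMr; exact: f_f.
- have := integrableZl measurableT C (density_integrable _ DQ).
  exact: eq_integrable.
- move=> n z _; rewrite abse_EFin lee_fin normrM (ger0_norm (ltW (Q_gt0 z))).
  by rewrite ler_wpM2r ?(ltW (Q_gt0 z))//; apply: coupled_mix_le; exact: (Hf_ n).2.
Qed.

Definition diagonal_mass (k : R) f : R :=
  k * \int[mu]_z (f (z, z) * Num.min (pa z) (pb z)).

Let s z := Num.min (pa z) (pb z).

Let s_gt0 z : 0 < s z. Proof. by rewrite lt_min pa_gt0 pb_gt0. Qed.

Let s_integrable : mu.-integrable setT (EFin \o (s : borel V -> R)).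
Proof.
apply: (@le_integrable _ _ _ _ _ measurableT _ (EFin \o (pa : borel V -> R))).
- by apply/measurable_EFinP; exact: measurable_minr Da.2.1 Db.2.1.
- move=> z _ /=; rewrite lee_fin (ger0_norm (ltW (s_gt0 z))).
  by rewrite (ger0_norm (ltW (pa_gt0 z))) ge_min lexx.
- exact: density_integrable.
Qed.

Let diag_integrable C f : bounded_mfun C f ->
  mu.-integrable setT (EFin \o ((fun z => f (z, z) * s z) : borel V -> R)).
Proof.
move=> [mf fC]; apply: (bounded_mulr_integrable _ C (fun z : borel V => f (z, z))) => //.
  split=> [|z]; last exact: fC.
  by apply: (measurableT_comp mf); apply: measurable_borel_pair.
by move=> z; exact: ltW.
Qed.

Lemma Pop_doeblin (M : R) : 1 <= M ->
  (forall z, pa z <= M * Q z) -> (forall z, pb z <= M * Q z) ->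
  doeblin_operator (P : (borel (V * V)%type -> R) -> borel (V * V)%type -> R)
    (diagonal_mass (2 * M)^-1) ((2 * M)^-1 * \int[mu]_z s z).
Proof.
move=> M1 paM pbM; have M0 : 0 < M by lra.
have k0 : 0 < (2 * M)^-1 by rewrite invr_gt0 mulr_gt0.
have s0 := Rintegral_gt0 mu (s : borel V -> R) s_gt0 s_integrable.
have s1 : \int[mu]_z s z <= 1.
  rewrite -(Rintegral_density _ Da); apply: le_Rintegral => //.
    exact: density_integrable.
  by move=> z _; rewrite ge_min lexx.
split.
- exact: Pop_measurable.
- move=> c C D f g Hf Hg t; exact: Pop_lin Hf Hg.
- exact: Pop_cst.
- exact: Pop_cvg.
(* The factor 2 keeps the minorizing mass at most one half, hence strictly below 1 even when
   [M = 1]. *)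
- rewrite mulr_gt0//= mulrC ltr_pdivrMr ?mulr_gt0// mul1r; lra.
- move=> C D f g Hf Hg; rewrite /diagonal_mass -mulrDr.
  rewrite -RintegralD//; [|exact: diag_integrable Hf|exact: diag_integrable Hg].
  by congr (_ * _); apply: eq_Rintegral => z _; rewrite mulrDl.
- by move=> c; rewrite /diagonal_mass RintegralZl// mulrCA mulrC.
- move=> f f0; apply: mulr_ge0; first exact: ltW.
  by apply: Rintegral_ge0 => z _; rewrite mulr_ge0// ltW// s_gt0.
- move=> C f Hf f0 t; rewrite (PopE _ _ t Hf) /diagonal_mass.
  rewrite -RintegralZl//; last exact: diag_integrable Hf.
  apply: le_Rintegral => //.
  + have := integrableZl measurableT (2 * M)^-1 (diag_integrable _ _ Hf).
    exact: eq_integrable.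
  + exact: coupled_mix_integrable Hf.
  + move=> z _; have Hmin := coupled_mix_ge f t z f0.
    apply: le_trans (ler_wpM2r (ltW (Q_gt0 z)) Hmin).
    rewrite mulrCA [leRHS]mulrAC [leRHS]mulrC ler_wpM2l//.
    (* The factor 2 is dropped here; [s z / M] lies below both bounds of [alpha_minor], as [s] lies
       below both densities. *)
    apply: (@le_trans _ _ (s z / M)).
      rewrite mulrC ler_wpM2l ?(ltW (s_gt0 z))// lef_pV2 ?posrE ?mulr_gt0//; lra.
    rewrite [leRHS]minr_pMl ?(ltW (Q_gt0 z))// le_min; apply/andP; split.
      apply: le_trans (alpha_minor _ _ pa_gt0 Q_gt0 _ _ _ M0 paM).
      by rewrite ler_wpM2r ?invr_ge0 ?(ltW M0)// ge_min lexx.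
    apply: le_trans (alpha_minor _ _ pb_gt0 Q_gt0 _ _ _ M0 pbM).
    by rewrite ler_wpM2r ?invr_ge0 ?(ltW M0)// ge_min lexx orbT.
Qed.

End coupled_kernel.

Theorem mainTheorem1 (R : realType) (V : completeNormedModType R)
  (Vsep : separable_space V)
  (mu : probability (borel V) R)
  (L : nat) (pi : nat -> V -> R) (Q : nat -> V -> R)
  (* each mu^y_j, j = 0..L, is a probability measure with density pi j *)
  (Hpi : forall j, (j <= L)%N -> is_density mu (pi j))
  (* each Q_l, l = 1..L, is a probability density *)
  (HQ : forall l, (1 <= l <= L)%N -> is_density mu (Q l))
  (* Assumption 1.1 *)
  (A11 : forall l, (1 <= l <= L)%N ->
     continuous (Q l) /\ forall z, 0 < Q l z)
  (* Assumption 1.2 *)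
  (A12 : forall j, (j <= L)%N -> continuous (pi j) /\ forall z, 0 < pi j z)
  (* Assumption 1.3 *)
  (A13 : forall l, (1 <= l <= L)%N -> forall j : nat, (j == l.-1) || (j == l) ->
     forall cr : R, 0 < cr -> compact [set th : V | Q l th / pi j th <= cr])
  (* Assumption 1.4 *)
  (A14 : exists c : R, 0 < c < 1 /\
     forall l, (1 <= l <= L)%N -> forall j : nat, (j == l.-1) || (j == l) ->
       (c%:E <= ess_inf mu (fun z : borel V => (Q l z / pi j z)%:E))%E)
  (* Assumption 1.5 *)
  (A15 : exists r : R, 1 < r /\ exists Cr : R, 0 < Cr /\
     forall l, (1 <= l <= L)%N ->
       (\int[mu]_z ((Q l z) `^ r)%:E <= Cr%:E)%E) :
  forall l, (1 <= l <= L)%N ->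
  exists nu : probability (borel (V * V)%type) R,
    (* (1) nu is the unique invariant probability measure *)
    kernel_invariant mu (pi l.-1) (pi l) (Q l) nu /\
    (forall nu' : probability (borel (V * V)%type) R,
       kernel_invariant mu (pi l.-1) (pi l) (Q l) nu' ->
       forall A : set (borel (V * V)%type), measurable A -> nu' A = nu A) /\
    (* (2) uniform ergodicity *)
    exists (W : borel (V * V)%type -> R) (Vmax : R),
      (forall t, 1 <= W t <= Vmax) /\
      nu.-integrable setT (EFin \o W) /\
      exists (r M : R), 0 < r < 1 /\ 0 < M /\
        forall f : borel (V * V)%type -> R, measurable_fun setT f ->
          (forall t, `|f t| <= W t) ->
          forall (t : V * V) (n : nat),
            `| iter n (fun g => Pop mu (pi l.-1) (pi l) (Q l) g) f t
               - \int[nu]_x f x | <= M * Vmax * r ^+ n.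
Proof.
move=> l lL; have /andP[l1 lL'] := lL.
have lL1 : (l.-1 <= L)%N by rewrite (leq_trans (leq_pred l)).
have [cQ Q0] := A11 l lL.
have [ca a0] := A12 _ lL1; have [cb b0] := A12 _ lL'.
have Ka : compact [set z | Q l z / pi l.-1 z <= 1].
  by apply: A13; rewrite ?eqxx.
have Kb : compact [set z | Q l z / pi l z <= 1].
  by apply: A13; rewrite ?eqxx ?orbT.
have [Ma Ma1 aM] := compact_sublevel_ratio_bound _ _ ca cQ a0 Q0 Ka.
have [Mb Mb1 bM] := compact_sublevel_ratio_bound _ _ cb cQ b0 Q0 Kb.
pose M := Num.max Ma Mb.
have M1 : 1 <= M by rewrite le_max Ma1.
have aM' z : pi l.-1 z <= M * Q l z.
  by rewrite (le_trans (aM z))// ler_wpM2r ?le_max ?lexx// ltW.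
have bM' z : pi l z <= M * Q l z.
  by rewrite (le_trans (bM z))// ler_wpM2r ?le_max ?lexx ?orbT// ltW.
have PD := Pop_doeblin mu _ _ _ Vsep (Hpi _ lL1) (Hpi _ lL') (HQ _ lL) a0 b0 Q0
  M M1 aM' bM'.
have [nu [inv uniq erg]] := doeblin_ergodic _ _ _ PD.
exists nu; split; first exact: inv.
split; first exact: uniq.
(* The contraction is uniform over the state space, so a constant weight function serves. *)
exists (cst 1), 1; split; first by move=> t; rewrite !lexx.
split; first exact: bounded_mfun_integrable (bounded_mfun_cst 1).
have beta01 := doeblin_rate _ _ _ PD.
set beta := (X in 0 < X < 1) in beta01 erg.
(* The constant 2 is the length of [[-1, 1]], the initial range allowed for [f]. *)
exists (1 - beta), 2; split; first by move: beta01; lra.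
split=> // f mf f1 t n.
by rewrite mulrC; exact: erg.
Qed.
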